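(* Let $1\le p\le n$ and let $A_1,\dots,A_p$ be real symmetric $n\times n$ matrices. For $U\in\mathcal M_{n\times p}(\mathbb R)$ with columns $\mathbf u_1,\dots,\mathbf u_p$ put $A(U)=[A_1\mathbf u_1,\dots,A_p\mathbf u_p]\in\mathcal M_{n\times p}(\mathbb R)$. A matrix $U\in St^n_p$ is a critical point of the cost function $St^n_p\to\mathbb R$, $U\mapsto\sum_{i=1}^p\mathbf u_i^TA_i\mathbf u_i$, if and only if: (i) $U^TA(U)=A(U)^TU$; (ii) $A(U)=UU^TA(U)$.
   Context: $St_p^n=\{U\in\mathcal M_{n\times p}(\mathbb R)\mid U^TU=\mathbb I_p\}$ is the orthogonal Stiefel manifold. *)

(* Defs.v *)
From HB Require Import structures.
From mathcomp Require Import all_boot all_order all_algebra.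
From mathcomp Require Import all_classical all_reals all_analysis.

Set Implicit Arguments.
Unset Strict Implicit.
Unset Printing Implicit Defensive.

Import Order.TTheory GRing.Theory Num.Theory.
Import numFieldNormedType.Exports.

Local Open Scope classical_set_scope.
Local Open Scope ring_scope.

Definition smooth_on {R : realType} {V : normedModType R} (I : set R)
    (c : R -> V) : Prop :=
  forall (k : nat) (t : R), I t -> derivable (derive1n k c) t 1.

(* [M] is meant to be an embedded submanifold of [V].  Its tangent vectors at
   [x] are the velocities at time 0 of the smooth curves of [M] through [x],
   and the differential at [x] of [f] restricted to [M] sends the velocity of
   [c] to the derivative of [f \o c] at 0; [x] is critical when this
   differential vanishes.  Only the values of [f] on [M] matter. *)
Definition critical_point {R : realType} {V : normedModType R} (M : set V)
    (f : V -> R) (x : V) : Prop :=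
  M x /\
  forall (e : R) (c : R -> V), 0 < e ->
    smooth_on [set` `]-e, e[%R] c ->
    (forall t : R, -e < t < e -> M (c t)) ->
    c 0 = x ->
    is_derive (0 : R) 1 (f \o c) 0.

Definition stiefel (R : realType) (n p : nat) : set 'M[R]_(n, p) :=
  [set U | U^T *m U = 1%:M].
Arguments stiefel R n p _ : clear implicits.

Definition colwise_mul {R : realType} {n p : nat} (A : 'I_p -> 'M[R]_n)
    (U : 'M[R]_(n, p)) : 'M[R]_(n, p) :=
  \matrix_(i < n, j < p) (A j *m col j U) i 0.

Definition cost {R : realType} {n p : nat} (A : 'I_p -> 'M[R]_n)
    (U : 'M[R]_(n, p)) : R :=
  \sum_(i < p) ((col i U)^T *m A i *m col i U) 0 0.

(* Main.v *)
(* With B = A(U), the derivative of the cost at U in the direction V is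
   2 tr(V^T B).  Every velocity V of a curve of the manifold through U makes
   V^T U skew-symmetric, so under (i) and (ii) the derivative is
   2 tr((V^T U)(U^T B)), the trace of a skew matrix times a symmetric one, and
   vanishes.  Conversely, rotating U in each coordinate plane shows that
   tr((W U)^T B) = 0 for the skew matrices W = E_ij - E_ji, that is, B U^T is
   symmetric.  Multiplying B U^T = U B^T by U on the right gives B = U B^T U;
   multiplying this by U^T on the left gives (i), and (ii) follows. *)

Require Import Defs.
From HB Require Import structures.
From mathcomp Require Import all_boot all_order all_algebra.
From mathcomp Require Import all_classical all_reals all_analysis.
From mathcomp Require Import ring.

Import Order.TTheory GRing.Theory Num.Theory.
Import numFieldNormedType.Exports.

Local Open Scope ring_scope.

Set Implicit Arguments.
Unset Strict Implicit.

Lemma mxtrace_delta_mul (K : comPzRingType) (n : nat) (M : 'M[K]_n) (i j : 'I_n) :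
  \tr (delta_mx i j *m M) = M j i.
Proof.
rewrite /mxtrace (bigD1 i) //= big1 ?addr0 => [|k ki]; rewrite mxE (bigD1 j) //=.
  rewrite mxE !eqxx mul1r big1 ?addr0 // => l lj.
  by rewrite mxE (negbTE lj) andbF mul0r.
rewrite mxE (negbTE ki) mul0r add0r big1 // => l lj.
by rewrite mxE (negbTE lj) andbF mul0r.
Qed.

(** Transposing [X *m Y] and using cyclicity shows that its trace equals its own negative; the
    characteristic is zero. *)
Lemma mxtrace_skew_sym (K : realDomainType) (n : nat) (X Y : 'M[K]_n) :
  X^T = - X -> Y^T = Y -> \tr (X *m Y) = 0.
Proof.
move=> skX symY; have : \tr (X *m Y) = - \tr (X *m Y).
  by rewrite -{1}mxtrace_tr trmx_mul skX symY mulmxN raddfN /= mxtrace_mulC.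
by move/eqP; rewrite -addr_eq0 -mulr2n mulrn_eq0 => /eqP.
Qed.

Lemma is_derive_mxP (R : realFieldType) (V : normedModType R) (m n : nat)
    (M : V -> 'M[R]_(m, n)) (t v : V) (dM : 'M[R]_(m, n)) :
  is_derive t v M dM <->
  forall i j, is_derive t v (fun x => M x i j) (dM i j).
Proof.
split=> [[MV <-] i j|H].
  rewrite derive_mx // mxE; apply: derivableP.
  by have /derivable_mxP := MV.
have MV : derivable M t v.
  by apply/derivable_mxP => i j; have [] := H i j.
split=> //; rewrite derive_mx //; apply/matrixP => i j; rewrite mxE.
by have [_ ->] := H i j.
Qed.

Lemma is_derive_mulmx (R : realFieldType) (V : normedModType R) (m n p : nat)
    (M : V -> 'M[R]_(m, n)) (N : V -> 'M[R]_(n, p)) (t v : V)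
    (dM : 'M[R]_(m, n)) (dN : 'M[R]_(n, p)) :
  is_derive t v M dM -> is_derive t v N dN ->
  is_derive t v (fun x => M x *m N x) (dM *m N t + M t *m dN).
Proof.
move=> /is_derive_mxP HM /is_derive_mxP HN; apply/is_derive_mxP => i j.
have -> : (fun x => (M x *m N x) i j) =
    \sum_(k < n) ((fun x => M x i k) * (fun x => N x k j)).
  by apply/funext => x; rewrite mxE fct_sumE.
have H k := is_deriveM (HM i k) (HN k j).
apply: is_derive_eq (is_derive_sum H) _.
rewrite !mxE -big_split /=; apply: eq_bigr => k _.
by rewrite addrC; congr (_ + _); rewrite -[LHS]/(_ * _) mulrC.
Qed.

Lemma is_derive_trmx (R : realFieldType) (V : normedModType R) (m n : nat)
    (M : V -> 'M[R]_(m, n)) (t v : V) (dM : 'M[R]_(m, n)) :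
  is_derive t v M dM -> is_derive t v (fun x => (M x)^T) dM^T.
Proof.
move=> /is_derive_mxP HM; apply/is_derive_mxP => i j; rewrite mxE.
have -> : (fun x => (M x)^T i j) = (fun x => M x j i).
  by apply/funext => x; rewrite mxE.
exact: HM.
Qed.

Lemma is_derive_col (R : realFieldType) (V : normedModType R) (m n : nat)
    (M : V -> 'M[R]_(m, n)) (t v : V) (dM : 'M[R]_(m, n)) (k : 'I_n) :
  is_derive t v M dM -> is_derive t v (fun x => col k (M x)) (col k dM).
Proof.
move=> /is_derive_mxP HM; apply/is_derive_mxP => i j; rewrite mxE.
have -> : (fun x => col k (M x) i j) = (fun x => M x i k).
  by apply/funext => x; rewrite mxE.
exact: HM.
Qed.

(** In the product rule for each quadratic form the constant [A k] contributes nothing, and by its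
    symmetry the two remaining terms are transposes of each other as scalars, whence the factor
    2. *)
Lemma is_derive_cost (R : realType) (n p : nat) (A : 'I_p -> 'M[R]_n)
    (hA : forall i, (A i)^T = A i) (c : R -> 'M[R]_(n, p)) (t : R)
    (dc : 'M[R]_(n, p)) :
  is_derive t 1 c dc ->
  is_derive t 1 (cost A \o c) (2 * \tr (dc^T *m colwise_mul A (c t))).
Proof.
move=> Hc.
have -> : cost A \o c =
    \sum_(k < p) (fun x => ((col k (c x))^T *m A k *m col k (c x)) 0 0).
  by apply/funext => x; rewrite fct_sumE.
have Hq k := proj1 (is_derive_mxP _ _ _ _) (is_derive_mulmx (is_derive_mulmx
  (is_derive_trmx (is_derive_col k Hc)) (is_derive_cst (A k) t 1))
  (is_derive_col k Hc)) 0 0.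
apply: is_derive_eq (is_derive_sum Hq) _.
rewrite /mxtrace mulr_sumr; apply: eq_bigr => k _ /=.
set u := col k (c t); set w := col k dc.
have -> : (dc^T *m colwise_mul A (c t)) k k = (w^T *m A k *m u) 0 0.
  rewrite -mulmxA !mxE; apply: eq_bigr => i _.
  by rewrite !mxE.
rewrite mulmx0 addr0 mxE mulr2n mulrDl mul1r; congr (_ + _).
have -> : u^T *m A k *m w = (w^T *m A k *m u)^T.
  by rewrite !trmx_mul trmxK hA mulmxA.
by rewrite mxE.
Qed.

(** The three coefficients are kept general so that the family is closed under differentiation;
    smoothness then follows by induction on the order. *)
Definition trig_curve (R : realType) (m n : nat) (P Q S : 'M[R]_(m, n)) (t : R) :
  'M[R]_(m, n) := P + sin t *: Q + cos t *: S.

Lemma is_derive_trig_curve (R : realType) (m n : nat) (P Q S : 'M[R]_(m, n)) (t : R) :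
  is_derive t 1 (trig_curve P Q S) (trig_curve 0 (- S) Q t).
Proof.
apply/is_derive_mxP => i j.
have -> : (fun x => trig_curve P Q S x i j) =
    cst (P i j) + (Q i j \*: (sin : R -> R)) + (S i j \*: (cos : R -> R)).
  by apply/funext => x; rewrite /trig_curve !mxE !fctE /= ![_ *: _]mulrC.
apply: is_derive_eq.
rewrite /trig_curve !mxE /GRing.scale /=; ring.
Qed.

Lemma smooth_trig_curve (R : realType) (m n : nat) (P Q S : 'M[R]_(m, n)) (I : set R) :
  smooth_on I (trig_curve P Q S).
Proof.
move=> k t _; elim: k P Q S => [|k IH] P Q S.
  by have [] := is_derive_trig_curve P Q S t.
rewrite derive1Sn.
have -> : derive1 (trig_curve P Q S) = trig_curve 0 (- S) Q.
  apply/funext => x; rewrite derive1E.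
  exact: (@derive_val _ _ _ _ _ _ _ (is_derive_trig_curve P Q S x)).
exact: IH.
Qed.

(* Rodrigues' formula: for W^3 = - W, the curve is t |-> exp (t W) U. *)
Lemma trig_curve_stiefel (R : realType) (n p : nat) (W : 'M[R]_n)
    (U : 'M[R]_(n, p)) (t : R) :
  W^T = - W -> W *m W *m W = - W -> stiefel R n p U ->
  stiefel R n p (trig_curve (U + W *m W *m U) (W *m U) (- (W *m W *m U)) t).
Proof.
rewrite /stiefel /= => WT W3 UU.
set s := sin t; set k := cos t.
(* [Q] is exp (t W), by Rodrigues' formula; it suffices that [Q] is orthogonal. *)
pose Q : 'M[R]_n := 1%:M + s *: W + (1 - k) *: (W *m W).
have -> : trig_curve (U + W *m W *m U) (W *m U) (- (W *m W *m U)) t = Q *m U.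
  rewrite /trig_curve /Q !mulmxDl mul1mx -!scalemxAl scalerBl scale1r scalerN.
  by rewrite -!addrA; congr (_ + _); rewrite addrCA.
have W4 : W *m W *m (W *m W) = - (W *m W) by rewrite mulmxA W3 mulNmx.
have W3' : W *m (W *m W) = - W by rewrite mulmxA.
have QQ : Q^T *m Q = 1%:M.
  have -> : Q^T = 1%:M - s *: W + (1 - k) *: (W *m W).
    rewrite /Q !linearD !linearZ /= trmx1 trmx_mul WT mulNmx mulmxN opprK.
    by rewrite scalerN.
  (* Once W^3 and W^4 are reduced to - W and - W^2, the product is 1 + (1 - k^2 - s^2) W^2. *)
  rewrite /Q !(mulmxDl, mulmxDr) !mulNmx -!scalemxAl -!scalemxAr !mul1mx !mulmx1.
  rewrite W4 W3 W3'.
  have E := cos2Dsin2 t; rewrite -/s -/k in E.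
  have {}E : s ^+ 2 = 1 - k ^+ 2 by rewrite -E addrC addKr.
  apply/matrixP => i j; rewrite !mxE; ring: E.
by rewrite trmx_mul -mulmxA (mulmxA Q^T) QQ mul1mx.
Qed.

Unset Implicit Arguments.
Set Strict Implicit.

Theorem theorem3p6 (R : realType) (n p : nat) (hp : (1 <= p <= n)%N)
    (A : 'I_p -> 'M[R]_n) (hA : forall i : 'I_p, (A i)^T = A i)
    (U : 'M[R]_(n, p)) (hU : stiefel R n p U) :
  critical_point (stiefel R n p) (cost A) U <->
  U^T *m colwise_mul A U = (colwise_mul A U)^T *m U /\
  colwise_mul A U = U *m U^T *m colwise_mul A U.
Proof.
set B := colwise_mul A U; split=> [[_ crit]|[symUB projB]].
  have symBU : B *m U^T = U *m B^T.
    apply/matrixP => i j; have [->|ij] := eqVneq i j.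
      (* The two sides are transposes of each other, so their diagonals agree. *)
      by rewrite -[in LHS](trmxK B) -trmx_mul mxE.
    pose W : 'M[R]_n := delta_mx i j - delta_mx j i.
    have WT : W^T = - W by rewrite linearB /= !trmx_delta opprB.
    (* On the plane of coordinates i and j, [W] is a quarter turn, and it vanishes on the other
       coordinates; hence W^3 = - W. *)
    have WW : W *m W = - (delta_mx i i + delta_mx j j).
      rewrite mulmxBl !mulmxBr !mul_delta_mx_cond !eqxx (eq_sym j i) (negbTE ij).
      by rewrite !mulr0n !mulr1n sub0r subr0 opprD addrC.
    have W3 : W *m W *m W = - W.
      rewrite WW mulNmx mulmxDl !mulmxBr !mul_delta_mx_cond !eqxx (eq_sym j i) (negbTE ij).
      by rewrite !mulr0n !mulr1n subr0 sub0r.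
    pose c := trig_curve (U + W *m W *m U) (W *m U) (- (W *m W *m U)).
    have c0 : c 0 = U.
      by rewrite /c /trig_curve sin0 cos0 scale0r scale1r addr0 addrK.
    have dc : is_derive (0 : R) 1 c (W *m U).
      apply: is_derive_eq (is_derive_trig_curve _ _ _ _) _.
      by rewrite /trig_curve sin0 cos0 scale0r scale1r !add0r.
    (* The radius 1 is arbitrary: this curve stays on the manifold for all times. *)
    have [_ d0] := crit 1 c ltr01 (@smooth_trig_curve R n p _ _ _ _)
      (fun t _ => trig_curve_stiefel t WT W3 hU) c0.
    have [_] := is_derive_cost hA dc.
    rewrite c0 d0 => /esym/eqP; rewrite mulf_eq0 pnatr_eq0 /= -/B.
    (* By cyclicity the vanishing trace becomes tr (W B U^T), the difference of the entries (j, i)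
       and (i, j) of B U^T. *)
    rewrite trmx_mul WT mulmxN mulNmx raddfN /= oppr_eq0 -mulmxA mxtrace_mulC -mulmxA.
    rewrite mulmxBl raddfB /= !mxtrace_delta_mul subr_eq0 => /eqP <-.
    by rewrite -[in LHS](trmxK B) -trmx_mul mxE.
  have defB : B = U *m B^T *m U by rewrite -symBU -mulmxA hU mulmx1.
  have symUB : U^T *m B = B^T *m U.
    by rewrite {1}defB !mulmxA hU mul1mx.
  by split=> //; rewrite -mulmxA symUB mulmxA.
split=> // e c e0 smc stc c0.
(* Order 0 of smoothness is already the derivability of [c] itself. *)
have dc := derivableP (smc 0%N 0 _).
have {}dc : is_derive (0 : R) 1 c ('D_1 c 0).
  by apply: dc; rewrite /= in_itv /= oppr_lt0 e0.
move: dc; set V := 'D_1 c 0 => dc.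
apply: is_derive_eq (is_derive_cost hA dc) _; rewrite c0 -/B.
have skVU : (V^T *m U)^T = - (V^T *m U).
  have [_ E] := is_derive_mulmx (is_derive_trmx dc) dc.
  have : is_derive (0 : R) 1 (fun t => (c t)^T *m c t) 0.
    (* The constraint is known only for -e < t < e, which is enough to differentiate it at 0. *)
    have : (\forall t \near (0 : R), cst (1%:M : 'M[R]_p) t = (c t)^T *m c t)%classic.
      have : ((0 : R) \in `]-e, e[) by rewrite in_itv /= oppr_lt0 e0.
      move=> /near_in_itvoo; apply: filterS => t; rewrite in_itv /= => te.
      exact/esym/stc.
    by move=> /near_eq_is_derive; apply; apply: is_derive_cst.
  move=> [_]; rewrite E c0 => /eqP; rewrite addr_eq0 => /eqP VU.
  by rewrite trmx_mul trmxK VU opprK.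
rewrite projB -(mulmxA U) (mulmxA V^T) mxtrace_skew_sym ?mulr0 //.
by rewrite trmx_mul trmxK symUB.
Qed.
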